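(* Let $l=5$, $r\in\{1,2\}$ and $a=[r]$. Then $p_{4,2}(1/a)$, $p_{4,1}(1/a)$ and $p_{8,3}(1/a)$ are in $S$.
   Context: For an integer $i$, $[i]=\sum x^{n^2}\in\mathbb{Z}/2[[x]]$, summed over $n\in\mathbb{Z}$ with $n\equiv i\pmod 5$. $S=\mathbb{Z}/2[[1],[2]]\subset\mathbb{Z}/2[[x]]$ is the subring generated by $[1]$ and $[2]$. $1/a$ is taken in the field $L$ of Laurent series over $\mathbb{Z}/2$. For $q$ a power of $2$ and $0\le j<q$, $p_{q,j}:L\to L$ is $\sum_n c_nx^n\mapsto\sum_{n\equiv j\pmod q}c_nx^n$. *)

(* Defs.v *)
From HB Require Import structures.
From mathcomp Require Import all_boot all_order all_algebra.
From mathcomp Require Import all_classical.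
From mathcomp Require Import zify.

Set Implicit Arguments.
Unset Strict Implicit.
Unset Printing Implicit Defensive.

Import Order.TTheory GRing.Theory Num.Theory.

Local Open Scope classical_set_scope.
Local Open Scope ring_scope.

Section LaurentSeries.
Variable F : fieldType.
Implicit Types (f g h : int -> F) (N M P n : int) (k : nat).

Definition zero_below f N := forall n, n < N -> f n = 0.

Definition laurent_pred : {pred (int -> F)} :=
  fun f => `[< exists N, zero_below f N >].

(* [lcoef u n] is the coefficient of x^n, for n a possibly negative integer. *)
Record laurent := Laurent { lcoef : int -> F; lcoefP : lcoef \in laurent_pred }.

HB.instance Definition _ := [isSub for lcoef].
HB.instance Definition _ := [Choice of laurent by <:].

Lemma laurent_predP f : reflect (exists N, zero_below f N) (f \in laurent_pred).
Proof. exact: asboolP. Qed.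

Lemma laurent_pred_zmod : zmod_closed laurent_pred.
Proof.
split; first by apply/laurent_predP; exists 0.
move=> f g /laurent_predP[N fN] /laurent_predP[M gM].
apply/laurent_predP; exists (Num.min N M) => n.
by rewrite lt_min => /andP[nN nM]; rewrite !fctE fN// gM// subr0.
Qed.

HB.instance Definition _ :=
  GRing.isZmodClosed.Build _ laurent_pred laurent_pred_zmod.
HB.instance Definition _ := [SubChoice_isSubZmodule of laurent by <:].

(* The sum has finite support when f and g vanish below some bound; see
   [convE]. *)
Definition conv f g : int -> F :=
  fun n => \sum_(i \in [set: int]) f i * g (n - i).

Lemma convE f g N M k : zero_below f N -> zero_below g M ->
  conv f g (N + M + k%:Z) = \sum_(i < k.+1) f (N + i%:Z) * g (M + (k - i)%:Z).
Proof.
move=> fN gM; rewrite /conv.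
pose r := [seq N + i%:Z | i <- iota 0 k.+1].
rewrite -(fsbig_widen [set` r] _ (fun i => f i * g (N + M + k%:Z - i)))//; last first.
  move=> i /= [_ ir]; have [/fN->|Ni] := ltP i N; first by rewrite mul0r.
  rewrite gM ?mulr0// ltNge; apply/negP => Mi; apply: ir.
  apply/mapP; exists `|i - N|%N; last by lia.
  by rewrite mem_iota; lia.
rewrite (fsbig_fwiden r)//; last 2 first.
- by rewrite map_inj_uniq ?iota_uniq// => i j; lia.
- by move=> i /= [].
rewrite big_map -[in RHS](big_mkord xpredT (fun i => f (N + i%:Z) * g (M + (k - i)%:Z))).
rewrite /index_iota subn0 !big_seq; apply: eq_bigr => i; rewrite mem_iota => ik.
by congr (_ * g _); lia.
Qed.

Lemma conv_below f g N M : zero_below f N -> zero_below g M ->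
  zero_below (conv f g) (N + M).
Proof.
move=> fN gM n nNM; rewrite /conv fsbig1// => i _.
have [/fN->|Ni] := ltP i N; first by rewrite mul0r.
by rewrite gM ?mulr0//; lia.
Qed.

Definition trunc f N k : {poly F} := \poly_(i < k.+1) f (N + i%:Z).

Lemma conv_trunc f g N M k K : zero_below f N -> zero_below g M -> (k <= K)%N ->
  conv f g (N + M + k%:Z) = (trunc f N K * trunc g M K)`_k.
Proof.
move=> fN gM kK; rewrite convE// coefM; apply: eq_bigr => i _.
by rewrite !coef_poly !ifT//; have := ltn_ord i; lia.
Qed.

Lemma eq_above f g N : zero_below f N -> zero_below g N ->
  (forall k, f (N + k%:Z) = g (N + k%:Z)) -> f = g.
Proof.
move=> fN gN fg; apply/funext => n.
have [nN|Nn] := ltP n N; first by rewrite fN// gN.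
by have -> : n = N + `|n - N|%:Z by lia.
Qed.

Lemma trunc_conv f g N M k j : zero_below f N -> zero_below g M -> (j <= k)%N ->
  (trunc (conv f g) (N + M) k)`_j = (trunc f N k * trunc g M k)`_j.
Proof. by move=> fN gM jk; rewrite coef_poly ltnS jk (conv_trunc fN gM jk). Qed.

Lemma conv_assoc f g h N M P :
  zero_below f N -> zero_below g M -> zero_below h P ->
  conv f (conv g h) = conv (conv f g) h.
Proof.
move=> fN gM hP; have fgNM := conv_below fN gM; have ghMP := conv_below gM hP.
apply: (@eq_above _ _ (N + M + P)); first by rewrite -addrA; exact: conv_below.
  exact: conv_below.
move=> k; rewrite -[in LHS](addrA N) !(@conv_trunc _ _ _ _ k k)//.
transitivity ((trunc f N k * (trunc g M k * trunc h P k))`_k).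
  rewrite coefM [RHS]coefM; apply: eq_bigr => i _.
  by rewrite trunc_conv// leq_subr.
rewrite mulrA coefM [RHS]coefM; apply: eq_bigr => i _.
by rewrite trunc_conv// -ltnS.
Qed.

Lemma conv_comm f g N M : zero_below f N -> zero_below g M ->
  conv f g = conv g f.
Proof.
move=> fN gM; apply: (@eq_above _ _ (N + M)); first exact: conv_below.
  by rewrite addrC; exact: conv_below.
by move=> k; rewrite [in RHS](addrC N) !(@conv_trunc _ _ _ _ k k)// mulrC.
Qed.

Definition delta0 : int -> F := fun n => (n == 0)%:R.

Lemma delta0_below : zero_below delta0 0.
Proof. by move=> n n0; rewrite /delta0 lt_eqF. Qed.

Lemma conv_delta0 f N : zero_below f N -> conv delta0 f = f.
Proof.
move=> fN; have d0 := delta0_below.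
apply: (@eq_above _ _ N) => //; first by rewrite -[N]add0r; exact: conv_below.
move=> k; rewrite -[in LHS](add0r N) convE// big_ord_recl big1 ?addr0.
  by rewrite subn0 /delta0 eqxx mul1r.
by move=> i _; rewrite /delta0 (_ : _ == 0 = false) ?mul0r//; lia.
Qed.

Lemma zero_belowW f N M : M <= N -> zero_below f N -> zero_below f M.
Proof. by move=> MN fN n nM; apply/fN/(lt_le_trans nM). Qed.

Lemma conv_addl f g h N M P :
  zero_below f N -> zero_below g M -> zero_below h P ->
  conv (f + g) h = conv f h + conv g h.
Proof.
move=> fN gM hP; pose Q := Num.min N M.
have fQ : zero_below f Q by apply: zero_belowW fN; rewrite ge_min lexx.
have gQ : zero_below g Q by apply: zero_belowW gM; rewrite ge_min lexx orbT.
have fgQ : zero_below (f + g) Q by move=> n nQ; rewrite fctE fQ// gQ// addr0.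
apply: (@eq_above _ _ (Q + P)); first exact: conv_below.
  by move=> n nQP; rewrite fctE !(conv_below _ hP nQP)// addr0.
move=> k; rewrite [in RHS]fctE !convE// -big_split/=; apply: eq_bigr => i _.
by rewrite fctE mulrDl.
Qed.

Definition lone : laurent :=
  Laurent (introT (laurent_predP delta0) (ex_intro _ 0 delta0_below)).

Lemma conv_laurent (u v : laurent) : conv (lcoef u) (lcoef v) \in laurent_pred.
Proof.
have [/laurent_predP[N uN] /laurent_predP[M vM]] := (lcoefP u, lcoefP v).
by apply/laurent_predP; exists (N + M); exact: conv_below.
Qed.

Definition lmul (u v : laurent) : laurent := Laurent (conv_laurent u v).

Lemma lmulA : associative lmul.
Proof.
move=> u v w; apply: val_inj => /=.
have [/laurent_predP[N uN] /laurent_predP[M vM]] := (lcoefP u, lcoefP v).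
have /laurent_predP[P wP] := lcoefP w.
exact: conv_assoc uN vM wP.
Qed.

Lemma lmulC : commutative lmul.
Proof.
move=> u v; apply: val_inj => /=.
have [/laurent_predP[N uN] /laurent_predP[M vM]] := (lcoefP u, lcoefP v).
exact: conv_comm uN vM.
Qed.

Lemma lmul1 : left_id lone lmul.
Proof.
move=> u; apply: val_inj => /=.
by have /laurent_predP[N uN] := lcoefP u; exact: conv_delta0 uN.
Qed.

Lemma lmulDl : left_distributive lmul +%R.
Proof.
move=> u v w; apply: val_inj => /=.
have [/laurent_predP[N uN] /laurent_predP[M vM]] := (lcoefP u, lcoefP v).
have /laurent_predP[P wP] := lcoefP w.
exact: conv_addl uN vM wP.
Qed.

Lemma lone_neq0 : lone != 0.
Proof.
apply/eqP => /(congr1 (fun u => lcoef u 0))/=.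
by rewrite /delta0 eqxx => /eqP; rewrite oner_eq0.
Qed.

HB.instance Definition _ := GRing.Zmodule_isComNzRing.Build laurent
  lmulA lmulC lmul1 lmulDl lone_neq0.

Section Inverse.
Variable u : nat -> F.
Hypothesis u0 : u 0%N != 0.

Fixpoint inv_coefs k : seq F :=
  if k is k'.+1 then
    let s := inv_coefs k' in
    rcons s (- (u 0%N)^-1 * \sum_(i < k) u i.+1 * s`_(k' - i))
  else [:: (u 0%N)^-1].

Lemma size_inv_coefs k : size (inv_coefs k) = k.+1.
Proof. by elim: k => //= k IHk; rewrite size_rcons IHk. Qed.

Lemma nth_inv_coefs k j : (j <= k)%N -> (inv_coefs k)`_j = (inv_coefs j)`_j.
Proof.
elim: k => [|k IHk]; first by rewrite leqn0 => /eqP->.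
rewrite leq_eqVlt => /predU1P[->//|jk].
by rewrite [inv_coefs k.+1]/= nth_rcons size_inv_coefs jk IHk.
Qed.

Lemma inv_coefsP k :
  \sum_(i < k.+1) u i * (inv_coefs (k - i))`_(k - i) = (k == 0%N)%:R.
Proof.
rewrite big_ord_recl subn0; case: k => [|k].
  by rewrite big_ord0 addr0 /= divff.
rewrite [X in u _ * X]/= nth_rcons size_inv_coefs ltnn eqxx.
rewrite mulrA mulrN divff// mulN1r addrC; apply/eqP; rewrite subr_eq0; apply/eqP.
apply: eq_bigr => i _; rewrite lift0 subSS; congr (_ * _).
by rewrite [RHS]nth_inv_coefs ?leq_subr.
Qed.

End Inverse.

Lemma laurent_inv_exists (v : laurent) : v != 0 -> exists w : laurent, w * v = 1.
Proof.
move=> v0; have /laurent_predP[M vM] := lcoefP v.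
have exk : exists k, lcoef v (M + k%:Z) != 0.
  apply: contra_notP (negP v0) => /forallNP vk; apply/eqP/val_inj => /=.
  apply: (@eq_above _ _ M) => // k; apply/eqP/negPn/negP; exact: vk.
pose m := ex_minn exk; pose N := M + m%:Z.
have [vN0 vN] : lcoef v N != 0 /\ zero_below (lcoef v) N.
  rewrite /N /m; case: ex_minnP => k vk kmin; split=> // n nk.
  have [/vM//|Mn] := ltP n M; apply/eqP/negPn/negP => vn.
  have := kmin `|n - M|%N; rewrite (_ : M + _ = n); last by lia.
  by move=> /(_ vn); lia.
pose u k := lcoef v (N + k%:Z).
have u0 : u 0%N != 0 by rewrite /u addr0.
pose w n := if n < - N then 0 else (inv_coefs u `|n + N|)`_`|n + N|.
have wN : zero_below w (- N) by move=> n nN; rewrite /w nN.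
exists (Laurent (introT (laurent_predP w) (ex_intro _ _ wN))).
rewrite mulrC; apply: val_inj => /=.
have vw : zero_below (conv (lcoef v) w) 0 by rewrite -(subrr N); exact: conv_below.
apply: eq_above vw delta0_below _ => k.
rewrite -[X in conv _ _ (X + _)](subrr N) convE// add0r /delta0.
rewrite [RHS](_ : _ = (k == 0%N)%:R)// -(inv_coefsP u0); apply: eq_bigr => i _.
rewrite /w ifF; last by lia.
by congr (_ * (inv_coefs u _)`__); lia.
Qed.

Definition linv (u : laurent) : laurent := xget 0 [set v | v * u = 1].

Lemma lmulVf (u : laurent) : u != 0 -> linv u * u = 1.
Proof. by move=> /laurent_inv_exists; exact: xgetPex. Qed.

Lemma linv0 : linv 0 = 0.
Proof.
by apply: xgetPN => v /=; rewrite mulr0 => /eqP; rewrite eq_sym oner_eq0.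
Qed.

HB.instance Definition _ := GRing.ComNzRing_isField.Build laurent lmulVf linv0.

Definition sect_coef (q j : nat) f : int -> F :=
  fun n => if (n == j %[mod q])%Z then f n else 0.

Lemma sect_laurent q j (u : laurent) : sect_coef q j (lcoef u) \in laurent_pred.
Proof.
have /laurent_predP[N uN] := lcoefP u; apply/laurent_predP; exists N => n nN.
by rewrite /sect_coef uN// if_same.
Qed.

(* p_{q,j}: keep the terms whose exponent is j modulo q. *)
Definition sect q j (u : laurent) : laurent := Laurent (sect_laurent q j u).

End LaurentSeries.

Notation L := (laurent 'F_2).

(* The exponents n^2 may repeat as n varies, so the coefficient of x^m in [i]
   is the number of the n that contribute to it, taken modulo 2. *)
Definition theta_index (i m : int) : set int :=
  [set n | (n = i %[mod 5])%Z /\ n ^+ 2 = m].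

Definition theta_coef (i : int) : int -> 'F_2 :=
  fun m => \sum_(n \in theta_index i m) (1 : 'F_2).

Lemma finite_theta_index i m : finite_set (theta_index i m).
Proof.
pose r := [seq n%:Z | n <- iota 0 `|m|.+1] ++ [seq - n%:Z | n <- iota 0 `|m|.+1].
apply: (@sub_finite_set _ _ [set` r]) => // n [_ nm]; rewrite /= mem_cat.
have le_nm : (`|n| <= `|m|)%N.
  by rewrite -nm abszX; case: `|n|%N => // k; exact: leq_pmulr.
have [n0|n0] := leP 0 n; apply/orP; [left|right]; apply/mapP; exists `|n|%N;
  by rewrite ?mem_iota; lia.
Qed.

Lemma theta_laurent i : theta_coef i \in @laurent_pred 'F_2.
Proof.
apply/laurent_predP; exists 0 => m m0; rewrite /theta_coef.
rewrite (_ : theta_index i m = set0) ?fsbig_set0//.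
by apply/seteqP; split=> // n [_ nm]; have := sqr_ge0 n; rewrite nm leNgt m0.
Qed.

(* The series [i], as an element of L. *)
Definition theta (i : int) : L := Laurent (theta_laurent i).

(* Z/2[[1], [2]], with Z/2[[x]] identified with its image in L; the smallest
   subring containing [1] and [2] is the same computed in either ring. *)
Definition Sring : set L :=
  smallest [set A : set L | GRing.subring_closed (mem A)]
    [set theta 1; theta 2].

(* Main.v *)
(* Write a = [r] and b for the other generator.  Since 2n runs over the even
   integers, [2i] agrees with [i]^4 in the exponents divisible by 4, and an odd
   square is 1 mod 8; hence A = a - b^4 has only exponents 1 mod 8, and likewise
   for b - a^4.  The rotation (u, v) |-> (u + v, u - v) shows that ab and (ab)^2
   have the same even part, which gives a^5 + b^5 + ab + (ab)^2 = 0.  As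
   a^(-4) and a^(-8) have exponents divisible by 4 and 8, expanding
   1/a = a^(-4) (b^4 + A)^3 = a^(-8) (b^4 + A)^7 isolates each section of 1/a as
   one monomial in b and A over a power of a, and the relation makes the
   division exact. *)
From HB Require Import structures.
Require Import Defs.
From mathcomp Require Import all_boot all_order all_algebra.
From mathcomp Require Import all_classical.
From mathcomp Require Import zify ring.

Import Order.TTheory GRing.Theory Num.Theory.
Local Open Scope classical_set_scope.
Local Open Scope ring_scope.

Set Implicit Arguments.
Unset Strict Implicit.
Unset Printing Implicit Defensive.

(** * Supports modulo [q] and the sections they determine *)

Section Support.
Variable F : fieldType.
Implicit Types (u v : laurent F) (q i j k : nat).

Definition supp q j u :=
  forall n : int, (n != j %[mod q])%Z -> lcoef u n = 0.

Lemma lcoefD u v n : lcoef (u + v) n = lcoef u n + lcoef v n.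
Proof. by []. Qed.

Lemma lcoefB u v n : lcoef (u - v) n = lcoef u n - lcoef v n.
Proof. by []. Qed.

Lemma eq_laurent u v : (forall n, lcoef u n = lcoef v n) -> u = v.
Proof. by move=> uv; apply/val_inj/funext. Qed.

Lemma supp_modn q i j u : i = j %[mod q] -> supp q i u -> supp q j u.
Proof.
by move=> ij ui n nj; apply: ui; move: nj; rewrite !modz_nat ij.
Qed.

Lemma supp_dvd q q' j u : (q %| q')%N -> supp q' j u -> supp q j u.
Proof.
move=> qq' uj n nj; apply: uj; apply: contra nj.
rewrite !eqz_mod_dvd; apply: dvdz_trans; exact: qq'.
Qed.

Lemma suppB q j u v : supp q j u -> supp q j v -> supp q j (u - v).
Proof. by move=> uj vj n nj; rewrite lcoefB uj// vj// subr0. Qed.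

Lemma suppD q j u v : supp q j u -> supp q j v -> supp q j (u + v).
Proof. by move=> uj vj n nj; rewrite lcoefD uj// vj// addr0. Qed.

Lemma suppMn q j u m : supp q j u -> supp q j (u *+ m).
Proof.
move=> uj; elim: m => [|m IHm]; first by move=> n nj; rewrite mulr0n.
by rewrite mulrS; exact: suppD.
Qed.

Lemma suppM q i j u v : supp q i u -> supp q j v -> supp q (i + j) (u * v).
Proof.
move=> ui vj n nij; rewrite /= /conv fsbig1// => k _.
have [ki|/ui->] := boolP (k == i %[mod q])%Z; last by rewrite mul0r.
rewrite vj ?mulr0//; apply: contra nij => nkj.
apply/eqP; rewrite -[n](subrK k) addrC PoszD -[LHS]modzDm (eqP ki) (eqP nkj).
exact: modzDm.
Qed.

Lemma supp1 q : supp q 0 (1 : laurent F).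
Proof. by move=> n; rewrite /= /delta0; case: (n =P 0) => // ->; rewrite eqxx. Qed.

Lemma suppX q j u m : supp q j u -> supp q (j * m) (u ^+ m).
Proof.
move=> uj; elim: m => [|m IHm]; first by rewrite muln0; exact: supp1.
by rewrite exprS mulnS; exact: suppM.
Qed.

Lemma sectD q j u v : sect q j (u + v) = sect q j u + sect q j v.
Proof.
apply: eq_laurent => n; rewrite lcoefD /= /sect_coef.
by case: ifP => // _; rewrite addr0.
Qed.

Lemma sect_id q j u : supp q j u -> sect q j u = u.
Proof.
by move=> uj; apply: eq_laurent => n; rewrite /= /sect_coef; case: ifPn => // /uj.
Qed.

(** A support known only modulo a divisor [q'] of [q] can suffice: exponents that differ from [j]
    modulo [q'] also differ modulo [q]. *)
Lemma sect_eq0 q q' i j u :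
  (q' %| q)%N -> i <> j %[mod q'] -> supp q' i u -> sect q j u = 0.
Proof.
move=> q'q ij ui; apply: eq_laurent => n; rewrite /= /sect_coef.
case: ifPn => //; rewrite eqz_mod_dvd => nj; apply: ui.
have {nj}/eqP-> : (n == j %[mod q'])%Z.
  by rewrite eqz_mod_dvd; apply: dvdz_trans nj; exact: q'q.
by rewrite !modz_nat; apply/eqP => -[ji]; exact/ij.
Qed.

Lemma sect0 q j : sect q j 0 = 0 :> laurent F.
Proof. by apply: eq_laurent => n; rewrite /= /sect_coef if_same. Qed.

Lemma sect_sum q j n (f : 'I_n -> laurent F) :
  sect q j (\sum_i f i) = \sum_i sect q j (f i).
Proof. by apply: (big_morph _ (@sectD q j)); exact: sect0. Qed.

Lemma supp_eq0 q i j u : i <> j %[mod q] -> supp q i u -> supp q j u -> u = 0.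
Proof. by move=> ij ui uj; rewrite -(sect_id uj) (sect_eq0 _ ij ui). Qed.

End Support.

(** * Squaring of Laurent series in characteristic 2 *)

Section Frobenius.
Implicit Types (u v : L) (p : {poly 'F_2}).

Lemma F2_sqr (c : 'F_2) : c ^+ 2 = c.
Proof. by case: c => [[|[|//]] c2]; apply/val_inj. Qed.

Lemma polyF2_sqr p : p ^+ 2 = p \Po 'X^2.
Proof.
have pchar2 : 2 \in [pchar {poly 'F_2}] by rewrite pchar_poly; exact: pchar_Fp.
rewrite -(pFrobenius_autE pchar2) comp_polyE -[in LHS](coefK p) poly_def rmorph_sum.
apply: eq_bigr => i _.
by rewrite /= pFrobenius_autE exprZn F2_sqr exprAC.
Qed.

(** A given coefficient of the square depends on finitely many coefficients of [u], so [u] may be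
    truncated to a polynomial, where squaring is the substitution of X^2. *)
Lemma lcoef_sqr u (n : int) : lcoef (u ^+ 2) (n * 2) = lcoef u n.
Proof.
have /laurent_predP[N uN] := lcoefP u; rewrite expr2.
have [nN|Nn] := ltP n N.
  by rewrite uN//; apply: (conv_below uN uN); lia.
pose k := `|n - N|%N; have -> : n * 2 = N + N + (k * 2)%:Z by rewrite /k; lia.
rewrite /= (conv_trunc uN uN (leqnn _)) -expr2 polyF2_sqr coef_comp_poly_Xn//.
rewrite dvdn_mull// mulnK// coef_poly ifT; last by lia.
by congr lcoef; rewrite /k; lia.
Qed.

Lemma lcoef_sqr_odd u (n : int) : lcoef (u ^+ 2) (n * 2 + 1) = 0.
Proof.
have /laurent_predP[N uN] := lcoefP u; rewrite expr2.
have [nN|Nn] := ltP n N.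
  by apply: (conv_below uN uN); lia.
pose k := `|n - N|%N.
have -> : n * 2 + 1 = N + N + (k * 2).+1%:Z by rewrite /k; lia.
rewrite /= (conv_trunc uN uN (leqnn _)) -expr2 polyF2_sqr coef_comp_poly_Xn//.
by rewrite ifF//; lia.
Qed.

Lemma supp_sqr u q j : supp q j u -> supp (q * 2) (j * 2) (u ^+ 2).
Proof.
move=> uj n nj; have [m [nE|nE]] : exists m, n = m * 2 \/ n = m * 2 + 1.
- by exists (n %/ 2)%Z; lia.
- rewrite nE lcoef_sqr uj//; apply: contra nj.
  by rewrite nE !eqz_mod_dvd !PoszM -mulrBl dvdz_mul2r.
- by rewrite nE lcoef_sqr_odd.
Qed.

(** Each squaring doubles the modulus, starting from modulus 1, where the condition is vacuous. *)
Lemma supp_X2n u m : supp (2 ^ m) 0 (u ^+ (2 ^ m)).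
Proof.
elim: m => [|m IHm]; first by move=> n; rewrite expn0 !modz1.
by rewrite expnSr exprM; exact: supp_sqr IHm.
Qed.

End Frobenius.

(** * Arithmetic of the series [i] and of their products *)

Section Theta.
Implicit Types (i j N n m : int) (K : nat).
Local Notation "m =5 n" := (m = n %[mod 5])%Z (at level 70).

Lemma theta_below i : zero_below (theta_coef i) 0.
Proof.
move=> m m0; rewrite /theta_coef (_ : theta_index i m = set0) ?fsbig_set0//.
by apply/seteqP; split=> // n [_ nm]; have := sqr_ge0 n; rewrite nm leNgt m0.
Qed.

Definition box K : seq int := [seq k%:Z - K%:Z | k <- iota 0 K.*2.+1].

Lemma mem_box K n : (n \in box K) = (`|n| <= K)%N.
Proof.
apply/mapP/idP => [[k]|nK]; first by rewrite mem_iota; lia.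
by exists (absz (n + K%:Z)); rewrite ?mem_iota; lia.
Qed.

Lemma uniq_box K : uniq (box K).
Proof. by rewrite map_inj_uniq ?iota_uniq// => m n; lia. Qed.

Lemma theta_coefE i m K : (`|m| <= K)%N ->
  theta_coef i m =
  \sum_(n <- box K | (n == i %[mod 5])%Z && (n ^+ 2 == m)) 1.
Proof.
move=> mK; rewrite bigfs ?uniq_box//.
  apply: eq_fsbigl; apply/seteqP; split=> n /=.
    by move=> [ni nm]; apply/andP; split; apply/eqP.
  by move=> /andP[/eqP ni /eqP nm].
move=> n /andP[_ /eqP nm]; rewrite mem_box; nia.
Qed.

Definition square_sums i j N : set (int * int) :=
  [set p | [/\ p.1 =5 i, p.2 =5 j & p.1 ^+ 2 + p.2 ^+ 2 = N]].

Lemma sum_pred1_box K x : (`|x| <= K)%N ->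
  \sum_(k <- box K) (k == x)%:R = 1 :> 'F_2.
Proof.
move=> xK; rewrite (bigD1_seq x) ?mem_box ?uniq_box//= eqxx big1 ?addr0//.
by move=> k /negPf->.
Qed.

Lemma lcoef_thetaM i j N :
  lcoef (theta i * theta j) N = \sum_(p \in square_sums i j N) (1 : 'F_2).
Proof.
(* This radius serves both factors: |k| <= |N| gives |N - k| <= 2|N|. *)
pose K := (`|N| * 2)%N.
pose c (p : int * int) := [&& (p.1 == i %[mod 5])%Z, (p.2 == j %[mod 5])%Z
                          & p.1 ^+ 2 + p.2 ^+ 2 == N].
transitivity (\sum_(n <- box K) \sum_(m <- box K) (c (n, m))%:R : 'F_2).
  transitivity (\sum_(k <- box `|N|) theta_coef i k * theta_coef j (N - k)).
    rewrite (fsbig_seq _ _ (uniq_box _)); apply/esym/fsbig_widen => // k [_ kN].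
    have {}kN : (`|N| < `|k|)%N by rewrite ltnNge -mem_box; apply/negP.
    have [k0|k0] := ltP k 0; first by rewrite /= theta_below ?mul0r.
    by rewrite /= (@theta_below j (N - k)) ?mulr0//; lia.
  transitivity (\sum_(k <- box `|N|) \sum_(n <- box K) \sum_(m <- box K)
    ((c (n, m))%:R * (k == n ^+ 2)%:R : 'F_2)).
    rewrite big_seq [RHS]big_seq; apply: eq_bigr => k; rewrite mem_box => kN.
    rewrite (@theta_coefE i k K); last by rewrite /K; lia.
    rewrite (@theta_coefE j (N - k) K); last by rewrite /K; lia.
    rewrite big_mkcond [X in _ * X]big_mkcond big_distrlr /=.
    apply: eq_bigr => n _; apply: eq_bigr => m _; rewrite /c /=.
    case: eqP => // _ /=; rewrite ?mul0r//.
    rewrite (eq_sym k); case: eqP => [<-|_]; rewrite ?mulr0 ?mul0r// mul1r mulr1.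
    by rewrite -[_ == N - _](inj_eq (addrI (n ^+ 2))) subrKC; case: ifP.
  rewrite exchange_big; apply: eq_bigr => n _ /=.
  rewrite exchange_big; apply: eq_bigr => m _ /=.
  (* A counted pair meets exactly one [k], namely n^2, which lies in the box since n^2 <= N. *)
  rewrite -mulr_sumr; have [/and3P[_ _ /eqP/= nmN]|_] := boolP (c (n, m)).
    by rewrite mul1r sum_pred1_box//; nia.
  by rewrite mul0r.
rewrite -(big_allpairs (F := fun p => (c p)%:R)).
rewrite (eq_bigr (fun p => if c p then 1 else 0)); last by move=> p _; case: (c p).
rewrite -big_mkcond bigfs.
- apply: eq_fsbigl; apply/seteqP; split=> p /=.
    by move=> /and3P[/eqP ? /eqP ? /eqP ?].
  by move=> [pi pj pN]; apply/and3P; split; apply/eqP.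
- by apply: allpairs_uniq; rewrite ?uniq_box// => -[? ?] [? ?].
- move=> [n m] /and3P[_ _ /eqP nmN] /negP[].
  have {}nmN : n ^+ 2 + m ^+ 2 = N by [].
  by apply: allpairs_f; rewrite mem_box /K; nia.
Qed.

Lemma eq_theta i j : i =5 - j -> theta i = theta j.
Proof.
move=> ij; apply: eq_laurent => m; rewrite /= /theta_coef.
apply: (reindex_fsbig -%R); split=> [n [nj nm]|n n' _ _|n [ni nm]] /=.
- by split; [lia|rewrite sqrrN].
- exact: oppr_inj.
- by exists (- n); rewrite ?opprK//; split; [lia|rewrite sqrrN].
Qed.

(** The bijection is n |-> 2n: a root of a multiple of 4 is even, and 2 is invertible modulo 5. *)
Lemma theta_mod4 i j M : i =5 2 * j ->
  lcoef (theta i) (M * 2 * 2) = lcoef (theta j) M.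
Proof.
move=> ij; rewrite /= /theta_coef.
apply: (reindex_fsbig ( *%R 2)); split=> [n [nj nm]|n n' _ _|n [ni nm]] /=.
- by split; [lia|rewrite -nm; ring].
- lia.
- have [q [nE|nE]] : exists q, n = 2 * q \/ n = 2 * q + 1 by exists (n %/ 2)%Z; lia.
    by exists q; rewrite ?nE//; move: nm; rewrite nE; split; [lia|rewrite expr2; lia].
  by move: nm; rewrite nE expr2; lia.
Qed.

Lemma supp_thetaB i j : i =5 2 * j -> supp 8 1 (theta i - theta j ^+ 4).
Proof.
move=> ij n n1; rewrite lcoefB (exprM _ 2 2).
have [|n4] := eqVneq n ((n %/ 4)%Z * 2 * 2).
  by move=> ->; rewrite (theta_mod4 _ ij) !lcoef_sqr subrr.
rewrite -(exprM _ 2 2) (@supp_X2n _ 2) ?subr0; last by lia.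
rewrite /= /theta_coef (_ : theta_index i n = set0) ?fsbig_set0//.
apply/seteqP; split=> // k [_]; rewrite expr2 => kn.
(* A square is 0, 1 or 4 modulo 8; [n4] excludes 0 and 4, and [n1] excludes 1. *)
have [q [kE|[kE|[kE|kE]]]] :
  exists q, k = 4 * q \/ k = 4 * q + 1 \/ k = 4 * q + 2 \/ k = 4 * q + 3.
- by exists (k %/ 4)%Z; lia.
- by move: kn; rewrite kE; lia.
- by move: kn; rewrite kE; lia.
- by move: kn; rewrite kE; lia.
- by move: kn; rewrite kE; lia.
Qed.

Lemma lcoef_thetaM_even M :
  lcoef (theta 1 * theta 2) (M * 2) = lcoef (theta 1 * theta 2) M.
Proof.
(* With [4] in place of [1], the rotation has the right residues: u = 4 and v = 2 give u + v = 1 and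
   u - v = 2 modulo 5. *)
rewrite -[in RHS](@eq_theta 4 1)// !lcoef_thetaM.
apply: (reindex_fsbig (fun p => (p.1 + p.2, p.1 - p.2))).
split=> [[u v] [/= u4 v2 uvM]|[u v] [u' v'] _ _ []|[n m] [/= n1 m2 nmM]] /=.
- by split=> /=; [lia|lia|rewrite -uvM; ring].
- by move=> uE vE; congr pair; lia.
(* Since n^2 + m^2 is even, [n] and [m] have the same parity; half their difference gives the
   preimage. *)
- have [s [nE|nE]] : exists s, n = m + 2 * s \/ n = m + 2 * s + 1.
  + by exists ((n - m) %/ 2)%Z; lia.
  + exists (m + s, s); last by rewrite /= nE; congr pair; lia.
    by split=> /=; [lia|lia|move: nmM; rewrite nE !expr2; lia].
  + by move: nmM; rewrite nE !expr2; lia.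
Qed.

End Theta.

(** * The algebraic relation between [1] and [2] *)

Lemma laurentF2_addrr (u : L) : u + u = 0.
Proof.
apply: eq_laurent => n; rewrite lcoefD.
by case: (lcoef u n) => [[|[|//]] c2]; apply/val_inj.
Qed.

(** The left side is supported both on even and on odd exponents, as two ways of writing it show. *)
Lemma theta_relation : let a := theta 1 in let b := theta 2 in
  a * b - a ^+ 2 * b ^+ 2 - a ^+ 5 - b ^+ 5 = 0.
Proof.
move=> a b; pose A := a - b ^+ 4; pose B := b - a ^+ 4.
have A1 : supp 2 1 A.
  (* Modulo 5, 1 is twice 3, so [2] is rewritten as [3]. *)
  apply: (@supp_dvd _ 2 8) => //; rewrite /A /b (@eq_theta 2 3)//.
  exact: supp_thetaB.
have B1 : supp 2 1 B by apply: (@supp_dvd _ 2 8) => //; exact: supp_thetaB.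
have X4_0 (u : L) : supp 2 0 (u ^+ 4).
  by apply: (@supp_dvd _ 2 4) => //; exact: (@supp_X2n u 2).
have ab1 : supp 2 1 (a * b - (a * b) ^+ 2).
  move=> n n1; have [m ->] : exists m, n = m * 2 by exists (n %/ 2)%Z; lia.
  by rewrite lcoefB lcoef_sqr lcoef_thetaM_even subrr.
apply: (@supp_eq0 _ 2 0 1) => //.
(* Even form: a product of two odd series, minus squares. *)
- rewrite (_ : _ - _ = A * B - a ^+ 4 * b ^+ 4 - (a * b) ^+ 2); last first.
    by rewrite /A /B; ring.
  apply: suppB; last exact: (@supp_X2n _ 1).
  apply: suppB; last exact: (@suppM _ 2 0 0).
  exact: (supp_modn _ (suppM A1 B1)).
(* Odd form: the even part of ab cancels against that of its square, and a fourth power times an odd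
   series is odd. *)
- rewrite (_ : _ - _ = (a * b - (a * b) ^+ 2) - a ^+ 4 * A - b ^+ 4 * B
      - (a ^+ 4 * b ^+ 4 + a ^+ 4 * b ^+ 4)); last by rewrite /A /B; ring.
  rewrite laurentF2_addrr subr0; apply: suppB; first apply: suppB => //.
    exact: (@suppM _ 2 0 1).
  exact: (@suppM _ 2 0 1).
Qed.

(** * Exact division by powers of [a] *)

Section Division.
Variables (F : fieldType) (a b : F).
Hypothesis a0 : a != 0.
Hypothesis rel : a * b - a ^+ 2 * b ^+ 2 - a ^+ 5 - b ^+ 5 = 0.
Let A := a - b ^+ 4.
(** [c] and [d] are the cofactors that the relation gives when b A is divided by a^2 and b^5 by
    a. *)
Let c := a ^+ 3 + b ^+ 2.
Let d := b - a ^+ 4 - a * b ^+ 2.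

Let bA : b * A = a ^+ 2 * c.
Proof. by apply/eqP; rewrite -subr_eq0 -rel; apply/eqP; rewrite /A /c; ring. Qed.

Let b5 : b ^+ 5 = a * d.
Proof. by apply/esym/eqP; rewrite -subr_eq0 -rel; apply/eqP; rewrite /d; ring. Qed.

Lemma div42 : a^-1 ^+ 4 * b ^+ 4 * A ^+ 2 = b ^+ 2 * c ^+ 2.
Proof.
have -> : a^-1 ^+ 4 * b ^+ 4 * A ^+ 2 = a^-1 ^+ 4 * b ^+ 2 * (b * A) ^+ 2 by ring.
by rewrite bA; move: (c) => c'; field.
Qed.

Lemma div41 : a^-1 ^+ 4 * b ^+ 8 * A =
  a ^+ 2 * b ^+ 2 * d + d - a ^+ 3 * b ^+ 4 - b ^+ 6.
Proof.
transitivity (a^-1 ^+ 4 * b ^+ 2 * b ^+ 5 * (b * A)); first by ring.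
rewrite bA b5.
(* One factor a^-1 is left over, on b^4 d; expanding this [d] produces another b^5, which supplies
   the missing [a]. *)
transitivity (a ^+ 2 * b ^+ 2 * d
    + a^-1 * (b ^+ 5 - a ^+ 4 * b ^+ 4 - a * b ^+ 6)).
  by rewrite /c /d; field.
by rewrite b5; move: (d) => d'; field.
Qed.

Lemma div83 : a^-1 ^+ 8 * b ^+ 16 * A ^+ 3 = d ^+ 2 * b ^+ 3 * c ^+ 3.
Proof.
transitivity (a^-1 ^+ 8 * (b ^+ 5) ^+ 2 * b ^+ 3 * (b * A) ^+ 3); first by ring.
by rewrite bA b5; move: (c) (d) => c' d'; field.
Qed.

End Division.

(** * Sections of 1/a as single binomial terms *)

Section SectionsOfInverse.
Variables (P : {pred L}) (a b : L).
Hypothesis P_subring : GRing.subring_closed P.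
HB.instance Definition _ := GRing.isSubringClosed.Build L P P_subring.
Hypotheses (Pa : a \in P) (Pb : b \in P).
Let A := a - b ^+ 4.
Hypothesis A1 : supp 8 1 A.
Hypothesis rel : a * b - a ^+ 2 * b ^+ 2 - a ^+ 5 - b ^+ 5 = 0.

(** The binomial terms of a^(-q) (b^4 + A)^(q-1). *)
Let term q i := a^-1 ^+ q * (b ^+ 4) ^+ (q.-1 - i) * A ^+ i *+ 'C(q.-1, i).

Let inv_sum q : (0 < q)%N -> a != 0 -> a^-1 = \sum_(i < q) term q i.
Proof.
case: q => // q _ a0; have aE : a = b ^+ 4 + A by rewrite /A; ring.
have -> : a^-1 = a^-1 ^+ q.+1 * a ^+ q.
  by rewrite exprS -mulrA -exprMn mulVf// expr1n mulr1.
rewrite [X in _ * X ^+ _]aE exprDn big_distrr; apply: eq_bigr => i _.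
by rewrite /= mulrnAr mulrA.
Qed.

Let term_supp q i : (4 %| q)%N -> supp 4 i (term q i).
Proof.
move=> /dvdnP[k ->]; apply: suppMn.
apply: (@supp_modn _ 4 (0 + 1 * i)); first by rewrite mul1n.
apply: suppM; last by apply: suppX; exact: (@supp_dvd _ 4 8).
apply: (@suppM _ 4 0 0); first by rewrite exprM; exact: (@supp_X2n _ 2).
by apply: (@suppX _ 4 0); exact: (@supp_X2n _ 2).
Qed.

Let sect4E j : a != 0 -> (j < 4)%N -> sect 4 j a^-1 = term 4 j.
Proof.
move=> a0 j4; rewrite {1}(@inv_sum 4)// sect_sum (bigD1 (Ordinal j4))//=.
rewrite sect_id ?big1 ?addr0//; last exact: term_supp.
move=> i ij; apply: (sect_eq0 _ _ (@term_supp 4 i _)) => //.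
by rewrite !modn_small// => /(@val_inj _ _ _ i (Ordinal j4)) /eqP; apply/negP.
Qed.

(** For odd [i] the exponent 7 - i is even, so that power of b^4 is a power of b^8. *)
Let term8_supp i : (i < 8)%N -> odd i -> supp 8 i (term 8 i).
Proof.
move=> i8 io; apply: suppMn.
apply: (@supp_modn _ 8 (0 + 1 * i)); first by rewrite mul1n.
apply: suppM; last exact: suppX.
apply: (@suppM _ 8 0 0); first exact: (@supp_X2n _ 3).
rewrite -exprM (_ : (4 * (8.-1 - i) = (8.-1 - i)./2 * 8)%N) ?exprM; last by lia.
exact: (@supp_X2n _ 3).
Qed.

Let sect8E : a != 0 -> sect 8 3 a^-1 = term 8 3.
Proof.
move=> a0; rewrite {1}(@inv_sum 8)// sect_sum (bigD1 (Ordinal (isT : 3 < 8)%N))//=.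
rewrite sect_id ?big1 ?addr0//; last exact: term8_supp.
(* Among the other indices only 7 is 3 modulo 4, and its term has support 7 modulo 8; the rest are
   separated modulo 4. *)
move=> i i3; have [i7|i7] := eqVneq (val i) 7%N.
  by apply: (sect_eq0 _ _ (@term8_supp i _ _)) => //=; rewrite i7.
apply: (sect_eq0 _ _ (@term_supp 8 i _)) => //.
by case: i i3 i7 => [[|[|[|[|[|[|[|[|//]]]]]]]] i8].
Qed.

Lemma mem_sect42 : a != 0 -> sect 4 2 a^-1 \in P.
Proof.
move=> a0; rewrite sect4E// /term rpredMn// -exprM div42//.
by rewrite !(rpredD, rpredM, rpredX).
Qed.

Lemma mem_sect41 : a != 0 -> sect 4 1 a^-1 \in P.
Proof.
move=> a0; rewrite sect4E// /term rpredMn// -exprM expr1 div41//.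
by rewrite !(rpredB, rpredD, rpredM, rpredX).
Qed.

Lemma mem_sect83 : a != 0 -> sect 8 3 a^-1 \in P.
Proof.
move=> a0; rewrite sect8E// /term rpredMn// -exprM div83//.
by rewrite !(rpredB, rpredD, rpredM, rpredX).
Qed.

End SectionsOfInverse.

Theorem theorem4p2 (r : int) (a : L) :
  r = 1 \/ r = 2 -> a = theta r ->
  [/\ Sring (sect 4 2 a^-1), Sring (sect 4 1 a^-1) & Sring (sect 8 3 a^-1)].
Proof.
move=> r12 ->.
(* Membership in the smallest subring is tested in each subring [P] containing both generators. *)
have key (P : set L) :
  GRing.subring_closed (mem P) -> [set theta 1; theta 2] `<=` P ->
  [/\ P (sect 4 2 (theta r)^-1), P (sect 4 1 (theta r)^-1)
    & P (sect 8 3 (theta r)^-1)].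
  (* If [r] were 0, its inverse would be 0 by convention, hence every section too, and 0 = 1 - 1 is
     in [P]. *)
  move=> Psub P12; have [r0|r0] := eqVneq (theta r) 0.
    have P0 : P 0 by have [P1 PB _] := Psub; rewrite -in_setE -(subrr 1); exact: PB.
    by rewrite r0 invr0 !sect0.
  have P1 : theta 1 \in P by apply/mem_set/P12; left.
  have P2 : theta 2 \in P by apply/mem_set/P12; right.
  have A1 : supp 8 1 (theta 1 - theta 2 ^+ 4).
    by rewrite (@eq_theta 2 3)//; exact: supp_thetaB.
  have B1 : supp 8 1 (theta 2 - theta 1 ^+ 4) by exact: supp_thetaB.
  have rel := theta_relation.
  (* The relation is symmetric, so r = 2 is the same argument with the generators exchanged. *)
  have rel' : theta 2 * theta 1 - theta 2 ^+ 2 * theta 1 ^+ 2 - theta 2 ^+ 5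
    - theta 1 ^+ 5 = 0 by rewrite -[RHS]rel; ring.
  case: r12 r0 => -> r0; split; apply: set_mem.
  - exact: (mem_sect42 Psub P1 P2).
  - exact: (mem_sect41 Psub P1 P2).
  - exact: (mem_sect83 Psub P1 P2).
  - exact: (mem_sect42 Psub P2 P1).
  - exact: (mem_sect41 Psub P2 P1).
  - exact: (mem_sect83 Psub P2 P1).
by split=> P [Psub P12]; have [] := key P Psub P12.
Qed.
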